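(* For every $n\ge 1$, the total number of weak left to right maxima, summed over all Dyck paths of semi-length $n$, equals \[ \sum_{r=1}^n \bigl(d(r+2)-d(r)\bigr)\left(\binom{2n-1}{n-r}-\binom{2n-1}{n-r-1}\right), \] where $d(m)$ is the number of positive divisors of $m$ (and $\binom{2n-1}{-1}=0$).
   Context: A Dyck path of semi-length $n$ is a lattice path from $(0,0)$ to $(2n,0)$ with $n$ up steps $(1,1)$ and $n$ down steps $(1,-1)$ never going below the $x$-axis. A peak is an up step immediately followed by a down step, and its height is the height of its top point. A weak left to right maximum is a peak whose height is greater than or equal to the heights of all peaks to its left. *)

(* Defs.v *)
From mathcomp Require Import all_boot all_order all_algebra.

Set Implicit Arguments.
Unset Strict Implicit.
Unset Printing Implicit Defensive.

Import Order.TTheory GRing.Theory Num.Theory.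
Local Open Scope ring_scope.

(* A lattice path starting at (0,0) is encoded by its word of steps:
   [true] is the up step (1,1) and [false] is the down step (1,-1). *)
Definition step (b : bool) : int := if b then 1 else -1.

(* The path visits the points (k, height s k), 0 <= k <= size s. *)
Definition height (s : seq bool) (k : nat) : int :=
  \sum_(b <- take k s) step b.

Definition is_dyck (n : nat) (s : seq bool) : bool :=
  [&& count_mem true s == n, count_mem false s == n
    & [forall k : 'I_(size s).+1, 0 <= height s k]].

(* A peak is represented by the (0-based) index [i] of its up step. *)
Definition is_peak (s : seq bool) (i : nat) : bool :=
  [&& (i.+1 < size s)%N, nth false s i & ~~ nth false s i.+1].

Definition peak_height (s : seq bool) (i : nat) : int := height s i.+1.

Definition weak_lr_max (s : seq bool) (i : nat) : bool :=
  is_peak s i &&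
  [forall j : 'I_i, is_peak s j ==> (peak_height s j <= peak_height s i)].

Definition num_weak_lr_max (s : seq bool) : nat :=
  #|[set i : 'I_(size s) | weak_lr_max s i]|.

Definition total_weak_lr_max (n : nat) : nat :=
  (\sum_(s : (2 * n).-tuple bool | is_dyck n s) num_weak_lr_max s)%N.

Definition num_divisors (m : nat) : nat := size (divisors m).

(* Binomial coefficient with an integer lower index, 0 when it is negative;
   the truncated subtraction of nat would give 'C(m, 0) = 1 for 'C(m, -1). *)
Definition binomz (m : nat) (k : int) : int :=
  match k with
  | Posz j => ('C(m, j))%:Z
  | Negz _ => 0
  end.

(* Main.v *)
(**
Fix a height h and put m = h + 2. Up to its i-th step, a path whose weak left
to right maximum at step i has height h stays in the strip [0, h]; afterwards
it is an arbitrary nonnegative path. Counting such pairs (path, i) with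
starting height a, by first steps, gives a linear recurrence that is solved by
the method of images: with b_N(x) the (antisymmetric) ballot number, the count
for a < h and length N is
  sum_(q >= 1) (b_N(2mq - 4 - a) - b_N(2mq - 2 + a)).
Writing P(r) = b_(2n-1)(2r - 1), this is for a = 0 and N = 2n the sum
  sum_(q >= 1) (P(qm - 2) - P(qm)),
and summing over m >= 3 counts the divisors at least 3 of r + 2 and of r.
Divisors 1 and 2 cancel, since r and r + 2 have the same parity.
*)
Require Import Defs.
From mathcomp Require Import all_boot all_order all_algebra.
From mathcomp Require Import zify ring.

Set Implicit Arguments.
Unset Strict Implicit.
Unset Printing Implicit Defensive.

Import Order.TTheory GRing.Theory Num.Theory.
Local Open Scope ring_scope.

(** * Unrestricted walks and ballot numbers *)

Fixpoint walks (N : nat) (x : int) : int :=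
  if N is M.+1 then walks M (x - 1) + walks M (x + 1) else (x == 0)%:Z.

(** For [x >= -1] this counts the nonnegative [N]-step walks from [x] to 0, by reflection in the
    wall -1. *)
Definition ballot (N : nat) (x : int) : int := walks N x - walks N (x + 2).

Lemma walks_opp N x : walks N (- x) = walks N x.
Proof.
elim: N x => [|N IH] x /=; first by rewrite oppr_eq0.
rewrite addrC -(IH (x - 1)) -(IH (x + 1)).
by congr (walks N _ + walks N _); lia.
Qed.

Lemma walks_eq0 N (x : int) : N%:Z < x -> walks N x = 0.
Proof.
elim: N x => [|N IH] x lt_Nx /=; first by case: eqP => //; lia.
by rewrite !IH //; lia.
Qed.

Lemma walks_bin N k : walks N (N%:Z - 2 * k%:Z) = 'C(N, k)%:Z.
Proof.
elim: N k => [|N IH] [|k]; rewrite [LHS]/=.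
- by [].
- by rewrite bin0n; lia.
- rewrite (_ : N.+1%:Z - 2 * 0%:Z - 1 = N%:Z - 2 * 0%:Z); last lia.
  by rewrite IH walks_eq0 ?bin0 //; lia.
- rewrite (_ : N.+1%:Z - 2 * k.+1%:Z - 1 = N%:Z - 2 * k.+1%:Z); last lia.
  rewrite (_ : N.+1%:Z - 2 * k.+1%:Z + 1 = N%:Z - 2 * k%:Z); last lia.
  by rewrite !IH binS PoszD.
Qed.

(** A negative [k] puts the end point beyond [N], out of reach, in agreement with [binomz]. *)
Lemma walks_binomz N (k : int) : walks N (N%:Z - 2 * k) = binomz N k.
Proof.
case: k => k; first exact: walks_bin.
by rewrite walks_eq0 //=; lia.
Qed.

Lemma ballotS N x : ballot N.+1 x = ballot N (x - 1) + ballot N (x + 1).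
Proof.
rewrite /ballot /= (_ : x + 2 - 1 = x - 1 + 2); last lia.
rewrite (_ : x + 2 + 1 = x + 1 + 2); last lia.
by ring.
Qed.

Lemma ballot0 (x : int) : 0 <= x -> ballot 0 x = (x == 0)%:Z.
Proof.
by move=> x_ge0; rewrite /ballot /= (_ : x + 2 == 0 = false) ?subr0 //; lia.
Qed.

Lemma ballotN1 N : ballot N (-1) = 0.
Proof. by rewrite /ballot walks_opp subrr. Qed.

Lemma ballot_eq0 N (x : int) : N%:Z < x -> ballot N x = 0.
Proof. by move=> lt_Nx; rewrite /ballot !walks_eq0 ?subrr //; lia. Qed.

(** * First-step recurrences from an arbitrary starting height *)

Fixpoint dyck_from (a : int) (s : seq bool) : bool :=
  if s is c :: s' then (0 <= a) && dyck_from (a + step c) s' else a == 0.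

(* Counts the peaks of height [h] of the path [s] started at height [a]
   before which the path never goes above [h]. *)
Fixpoint records (h a : int) (s : seq bool) : nat :=
  if s is c :: s' then
    ([&& c, ~~ head true s' & (a + 1 == h)%R] +
     (if (a + step c <= h)%R then records h (a + step c)%R s' else 0))%N
  else 0%N.

Definition num_dyck_from (a : int) (N : nat) : int :=
  \sum_(s : N.-tuple bool) (dyck_from a s)%:Z.

Definition num_records (h a : int) (N : nat) : int :=
  \sum_(s : N.-tuple bool | dyck_from a s) (records h a s)%:Z.

Lemma sum_tupleS (N : nat) (f : seq bool -> int) :
  \sum_(s : N.+1.-tuple bool) f s =
  \sum_(s : N.-tuple bool) f (true :: s) +
  \sum_(s : N.-tuple bool) f (false :: s).
Proof.
rewrite (reindex (fun p : bool * N.-tuple bool => [tuple of p.1 :: p.2])) /=.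
  by rewrite -(pair_big xpredT xpredT (fun c (s : N.-tuple bool) => f (c :: s)))
    /= big_bool.
exists (fun t => (thead t, [tuple of behead t])) => [[c s] _|t _] /=.
  by rewrite theadE; congr (_, _); apply: val_inj.
by rewrite [RHS]tuple_eta.
Qed.

Lemma sum_tuple0 (f : seq bool -> int) : \sum_(s : 0.-tuple bool) f s = f [::].
Proof.
rewrite (eq_bigr (fun=> f [::])) => [|s _]; last by rewrite tuple0.
by rewrite sumr_const card_tuple.
Qed.

(** Both sides vanish at the wall -1, which a down step from 0 reaches, and satisfy the same
    first-step recurrence above it. *)
Lemma num_dyck_fromE (a : int) N : -1 <= a -> num_dyck_from a N = ballot N a.
Proof.
elim: N a => [|N IH] a a_geN1; rewrite /num_dyck_from.
  rewrite (sum_tuple0 (fun s => (dyck_from a s)%:Z)) /=.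
  by have [->|neq_a] := eqVneq a (-1); rewrite ?ballotN1 ?ballot0 //; lia.
case: (a =P -1) => [->|neq_a].
  by rewrite ballotN1 big1 // => s _; case: s => [[|c s]].
rewrite (sum_tupleS N (fun s => (dyck_from a s)%:Z)) /=.
have -> : 0 <= a by lia.
by rewrite /= ballotS addrC -!IH //; lia.
Qed.

Lemma num_records_small (h a : int) N : (N <= 1)%N -> num_records h a N = 0.
Proof.
case: N => [|[|//]] _; apply: big1 => s _; case: s => [[|c [|]]] //= _.
by rewrite andbF if_same.
Qed.

Lemma num_records_lt0 (h a : int) N : a < 0 -> num_records h a N = 0.
Proof.
move=> a_lt0; apply: big1 => s; case: s => [[|c s]] //= _.
by rewrite leNgt a_lt0.
Qed.

(** Split by the first step. If it goes up to [h] and a down step follows, there is a record, and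
    the path is back at [a] with [N] steps left and no ceiling: this gives the first summand. *)
Lemma num_recordsSS (h a : int) N : 0 <= a -> a <= h ->
  num_records h a N.+2 =
  (if a + 1 == h then num_dyck_from a N else 0) +
  num_records h (a - 1) N.+1 +
  (if a + 1 <= h then num_records h (a + 1) N.+1 else 0).
Proof.
move=> a_ge0 le_ah; rewrite /num_records big_mkcond /=.
rewrite (sum_tupleS _ (fun s => if dyck_from a s then (records h a s)%:Z else 0)).
rewrite /= a_ge0 /= (_ : a - 1 <= h = true); last lia.
rewrite [X in X + _ = _](eq_bigr (fun s : N.+1.-tuple bool =>
  (if (a + 1 == h) && ~~ head true s then (dyck_from (a + 1) s)%:Z else 0) +
  (if a + 1 <= h then if dyck_from (a + 1) s then (records h (a + 1) s)%:Z else 0 else 0)));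
  last first.
  move=> s _; rewrite [~~ _ && _]andbC; case: dyck_from; case: andP => _;
  by case: ifP.
rewrite big_split /= [X in X = _]addrAC -!addrA; congr (_ + _); last first.
  congr (_ + _); last by case: ifP => _; rewrite -?big_mkcond // big1.
  by rewrite [RHS]big_mkcond.
case: (a + 1 =P h) => /= [_|_]; last by rewrite big1.
rewrite (sum_tupleS _ (fun s => if ~~ head true s then (dyck_from (a + 1) s)%:Z else 0)).
rewrite /= big1 // add0r; apply: eq_bigr => s _.
by rewrite (_ : 0 <= a + 1 = true) /= ?addrK //; lia.
Qed.

(** * Solution of the recurrence by images *)

(* The images of [a] under the reflections in the walls [-1] and [m - 1],
   truncated at [L]; all dropped terms vanish when [M <= L]. *)
Definition images (m : int) L M (a : int) : int :=
  \sum_(1 <= q < L.+1)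
    (ballot M (2 * m * q%:Z - 4 - a) - ballot M (2 * m * q%:Z - 2 + a)).

Lemma imagesS m L M a : images m L M.+1 a = images m L M (a - 1) + images m L M (a + 1).
Proof.
rewrite /images -big_split; apply: eq_bigr => q _; rewrite !ballotS.
set x := 2 * m * q%:Z; rewrite /=.
rewrite (_ : x - 4 - (a - 1) = x - 4 - a + 1); last ring.
rewrite (_ : x - 2 + (a - 1) = x - 2 + a - 1); last ring.
rewrite (_ : x - 4 - (a + 1) = x - 4 - a - 1); last ring.
rewrite (_ : x - 2 + (a + 1) = x - 2 + a + 1); last ring.
ring.
Qed.

Lemma images_lower_wall m L M : images m L M (-1) = 0.
Proof.
apply: big1 => q _; apply/eqP; rewrite subr_eq0; apply/eqP; congr ballot; ring.
Qed.

(** At this wall the sum telescopes: the term of [q] is the difference of the ballot numbers at 2m(q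
    - 1) + m - 3 and 2mq + m - 3. The last argument exceeds [M]. *)
Lemma images_upper_wall m L M : 3 <= m -> (M < L)%N ->
  images m L M (m - 1) = ballot M (m - 3).
Proof.
move=> m_ge3 lt_ML.
rewrite /images big_add1 /= (eq_bigr (fun q => - (ballot M (2 * m * q.+1%:Z + m - 3)
   - ballot M (2 * m * q%:Z + m - 3)))) => [|q _]; last first.
  rewrite [RHS]opprB; congr (ballot M _ - ballot M _); rewrite intS; ring.
rewrite sumrN telescope_sumr // mulr0 add0r ballot_eq0 ?sub0r ?opprK //.
nia.
Qed.

(** All arguments are at least [m - 1 >= 2], hence greater than [M]. *)
Lemma images_small m L M (a : int) : 3 <= m -> (M <= 1)%N -> 0 <= a -> a <= m - 3 ->
  images m L M a = 0.
Proof.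
move=> m_ge3 M_le1 a_ge0 le_am; rewrite /images big_nat big1 // => q /andP[q_gt0 _].
by rewrite !ballot_eq0 ?subrr //; nia.
Qed.

(* [images] also satisfies the recurrence of [num_recordsSS]: for [a = h] it
   exceeds [num_records] by exactly the term created at [a = h - 1], by
   [images_upper_wall]. *)
Lemma num_recordsE (h a : int) L M : 1 <= h -> 0 <= a -> a < h -> (M <= L)%N ->
  num_records h a M = images (h + 2) L M a.
Proof.
move=> h_ge1; have [k le_Mk] := ubnP M.
elim: k M le_Mk a => // k IH [|[|M]] le_Mk a a_ge0 lt_ah le_ML.
- by rewrite num_records_small // images_small //; lia.
- by rewrite num_records_small // images_small //; lia.
rewrite num_recordsSS //; last lia.
have eq_down : num_records h (a - 1) M.+1 = images (h + 2) L M.+1 (a - 1).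
  have [a_gt0|a_le0] := ltrP 0 a; first by apply: IH; lia.
  have -> : a = 0 by lia.
  by rewrite num_records_lt0 // sub0r images_lower_wall.
rewrite imagesS eq_down (_ : a + 1 <= h = true); last lia.
have [eq_ah|neq_ah] := eqVneq (a + 1) h; last by rewrite add0r IH //; lia.
rewrite [X in X + _]addrC -addrA; congr (_ + _).
(* A second unfolding, at [h], reaches the upper wall [h + 1], whose value [ballot M (h - 1)] is the
   peak term. *)
rewrite imagesS num_dyck_fromE; last lia.
rewrite [X in X + images _ _ _ (a + 1 + 1)](_ : _ = num_records h (a + 1) M.+1).
  rewrite addrC; congr (_ + _); rewrite (_ : a + 1 + 1 = h + 2 - 1); last lia.
  by rewrite images_upper_wall; [congr ballot; lia|lia|lia].
rewrite addrK eq_ah; case: M le_Mk le_ML eq_down => [|M] le_Mk le_ML _.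
  by rewrite num_records_small // images_small //; lia.
(* From [h] a path can only step down to [h - 1], and no record arises at once. *)
rewrite num_recordsSS; [|lia|lia].
rewrite (_ : h + 1 == h = false); last lia.
rewrite (_ : h + 1 <= h = false); last lia.
by rewrite add0r addr0 -IH //; [congr num_records|..]; lia.
Qed.

(** * Weak maxima of Dyck words as records *)

Lemma height0 s : height s 0 = 0.
Proof. by rewrite /height take0 big_nil. Qed.

Lemma height_cons c s k : height (c :: s) k.+1 = step c + height s k.
Proof. by rewrite /height /= big_cons. Qed.

Lemma heightS s k : (k < size s)%N -> height s k.+1 = height s k + step (nth false s k).
Proof.
elim: s k => // c s IH [|k] lt_ks; first by rewrite height_cons !height0 addrC.
by rewrite !height_cons /= IH // addrA.
Qed.

Lemma height_le s k : height s k <= k%:Z.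
Proof.
elim: s k => [|c s IH] [|k]; rewrite ?height0 //; first by rewrite /height big_nil.
by rewrite height_cons; move: (IH k); case: c => /=; lia.
Qed.

Lemma height_size s : height s (size s) = (count_mem true s)%:Z - (count_mem false s)%:Z.
Proof.
elim: s => [|c s IH]; first by rewrite height0.
by rewrite height_cons IH; case: c => /=; lia.
Qed.

Lemma dyck_fromP (a : int) s :
  reflect ((forall k, (k <= size s)%N -> 0 <= a + height s k) /\
           a + height s (size s) = 0)
          (dyck_from a s).
Proof.
elim: s a => [|c s IH] a /=.
  apply: (iffP eqP) => [-> | [_]]; last by rewrite height0 addr0.
  by split=> [[|k]|]; rewrite ?height0.
apply: (iffP andP) => [[a_ge0 /IH[nneg end0]] | [nneg end0]].
  split=> [[|k] le_ks|]; rewrite ?height0 ?addr0 ?height_cons ?addrA //.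
  exact: nneg.
split; first by have := nneg 0%N isT; rewrite height0 addr0.
apply/IH; split=> [k le_ks|]; last by rewrite -addrA -height_cons.
by rewrite -addrA -height_cons nneg.
Qed.

Lemma is_dyckE n (s : (2 * n).-tuple bool) : is_dyck n s = dyck_from 0 s.
Proof.
have size_s : (count_mem true s + count_mem false s)%N = (2 * n)%N.
  by rewrite -[RHS](size_tuple s) -(count_predC (pred1 true)); congr addn; apply: eq_count; case.
have end_s := height_size s.
apply/and3P/dyck_fromP => [[/eqP n_up /eqP n_down /forallP nneg] | [nneg end0]].
  split=> [k le_ks|]; last lia.
  by rewrite add0r; have := nneg (Ordinal (le_ks : k < (size s).+1)%N).
split; [apply/eqP; lia|apply/eqP; lia|].
by apply/forallP => -[k lt_ks] /=; rewrite -[height _ _]add0r nneg.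
Qed.

Lemma records_sum (h a : int) s :
  records h a s = (\sum_(i < size s) [&& is_peak s i, (a + height s i.+1 == h)%R
    & all (fun k => (a + height s k.+1 <= h)%R) (iota 0 i)])%N.
Proof.
elim: s a => [|c s IH] a /=; first by rewrite big_ord0.
rewrite big_ord_recl /= height_cons height0 addr0 andbT; congr (_ + _)%N.
  by case: s {IH} => [|d s]; rewrite /is_peak ?andbF //=; case: c; case: d.
have [le_ah | lt_ha] := boolP (a + step c <= h)%R; last first.
  by rewrite big1 // => i _; rewrite !andbF.
rewrite IH; apply: eq_bigr => i _.
rewrite /bump /= add1n -[1%N]addn0 iotaDl /= all_map height_cons !addrA /=.
by rewrite (@eq_all _ _ (fun k => (a + step c + height s k.+1 <= h)%R)) // => k;
  rewrite /= add1n height_cons addrA.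
Qed.

(* Some highest point of the path before a peak [i] violating the right-hand
   side is the top of a peak higher than [i]. *)
Lemma weak_lr_maxE s i : (forall k, (k <= size s)%N -> 0 <= height s k) ->
  weak_lr_max s i =
  is_peak s i && all (fun k => height s k.+1 <= height s i.+1) (iota 0 i).
Proof.
move=> nneg; rewrite /weak_lr_max; have [peak_i | //] := boolP (is_peak s i).
have /and3P[lt_is up_i _] := peak_i.
rewrite /=; apply/idP/idP => [/forallP max_i | /allP le_i]; last first.
  by apply/forallP => j; apply/implyP => _; apply: le_i; rewrite mem_iota /=.
apply/allP => k; rewrite mem_iota add0n /= => lt_ki.
pose o := [arg max_(j > (Ordinal lt_ki) ) height s j.+1]%O.
have o_max j : (j < i)%N -> height s j.+1 <= height s o.+1.
  move=> lt_ji; rewrite /o; case: arg_maxP => //= j0 _ j0_max.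
  exact: (j0_max (Ordinal lt_ji)).
apply: le_trans (o_max k lt_ki) _; rewrite leNgt; apply/negP => lt_io.
have := max_i o; rewrite /peak_height implybE (lt_geF lt_io) orbF => /negP; apply.
have lt_oi := ltn_ord o.
have hi : height s i.+1 = height s i + 1 by rewrite heightS ?up_i //; lia.
apply/and3P; split; first lia.
- have ho : height s o.+1 = height s o + step (nth false s o) by apply: heightS; lia.
  (* A down step into the highest point would start from a higher one, or from 0 and go below the
     axis. *)
  apply/negPn/negP => /negPf down_o; rewrite down_o /= in ho.
  case: (o : nat) lt_oi ho lt_io (o_max o.-1) => [|j] lt_ji ho lt_io oj.
    by have := nneg i; rewrite height0 in ho; lia.
  by have /= := oj (ltnW lt_ji); lia.
- have ho : height s o.+2 = height s o.+1 + step (nth false s o.+1) by apply: heightS; lia.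
  apply/negP => up_o; rewrite up_o /= in ho.
  (* An up step out of it would lead to a higher point before [i], or to the top of the peak [i]
     itself. *)
  have [lt_o1i|le_io1] := ltnP o.+1 i; first by have := o_max _ lt_o1i; lia.
  have : height s i.+1 = height s o.+2 by congr height; lia.
  by lia.
Qed.

Lemma num_weak_lr_maxE s K : dyck_from 0 s -> (size s < K)%N ->
  num_weak_lr_max s = (\sum_(1 <= h < K) records h%:Z 0 s)%N.
Proof.
move=> /dyck_fromP[nneg _] lt_sK.
have {}nneg k : (k <= size s)%N -> 0 <= height s k by move/nneg; rewrite add0r.
under eq_bigr do rewrite records_sum.
rewrite exchange_big /= /num_weak_lr_max -sum1dep_card big_mkcond /=.
apply: eq_bigr => i _; rewrite weak_lr_maxE //.
have [peak_i | _] /= := boolP (is_peak s i); last by rewrite big1.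
have /and3P[lt_is up_i _] := peak_i.
have hi : height s i.+1 = height s i + 1 by rewrite heightS ?up_i //; lia.
have hi_ge0 : 0 <= height s i by apply: nneg; lia.
have hi_le := height_le s i.+1.
(* A peak counts for just one [h], its own height, which lies between 1 and [size s]. *)
rewrite (bigD1_seq `|height s i.+1|%N) ?iota_uniq ?mem_index_iota //=; last lia.
rewrite big1 => [|h]; last by rewrite add0r; case: eqP => //; lia.
rewrite addn0 add0r (_ : `|height s i.+1|%N%:Z = height s i.+1); last lia.
rewrite eqxx /= (@eq_all _ _ (fun k => height s k.+1 <= height s i.+1)).
  by case: all.
by move=> k /=; rewrite add0r.
Qed.

Lemma total_weak_lr_maxE n :
  (total_weak_lr_max n)%:Z = \sum_(1 <= h < (2 * n).+1) num_records h%:Z 0 (2 * n).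
Proof.
rewrite /total_weak_lr_max (big_morph Posz PoszD (erefl 0%:Z)) /num_records.
rewrite exchange_big /= (eq_bigl (fun s : (2 * n).-tuple bool => dyck_from 0 s)); last exact: is_dyckE.
apply: eq_bigr => s dyck_s.
by rewrite (num_weak_lr_maxE dyck_s (ltnSn _)) size_tuple (big_morph Posz PoszD (erefl 0%:Z)).
Qed.

(** * Divisor sums and the final formula *)

Lemma num_divisorsE m K : (0 < m)%N -> (m < K)%N ->
  num_divisors m = (\sum_(1 <= d < K) (d %| m))%N.
Proof.
move=> m_gt0 lt_mK; rewrite /num_divisors.
rewrite -big_mkcond sum1_count -size_filter; apply: perm_size.
apply: uniq_perm; rewrite ?divisors_uniq ?filter_uniq ?iota_uniq // => d.
rewrite -dvdn_divisors // mem_filter mem_index_iota andbC.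
case: (boolP (d %| m)%N) => [d_m|]; last by rewrite andbF.
have := dvdn_leq m_gt0 d_m.
by have := dvdn_gt0 m_gt0 d_m; lia.
Qed.

(* The number of divisors of [r] that are at least 3. *)
Definition large_divisors (r : nat) : int :=
  (num_divisors r)%:Z - 1 - (2 %| r)%N%:Z.

(** Group the terms by r = q(h + 2). The bounds on [R] ensure that [h + 2] meets every divisor of
    [r] from 3 on, and [q] every cofactor. *)
Lemma sum_multiples (G : nat -> int) (H L R : nat) :
  (forall r, (R < r)%N -> G r = 0) -> (0 < H)%N -> (R <= H.+1)%N -> (R <= L)%N ->
  \sum_(1 <= h < H) \sum_(1 <= q < L.+1) G (q * (h + 2))%N =
  \sum_(1 <= r < R.+1) large_divisors r * G r.
Proof.
move=> G0 H_gt0 le_RH le_RL.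
have pick h q : (0 < q)%N -> G (q * (h + 2))%N =
    \sum_(1 <= r < R.+1) (q * (h + 2) == r)%N%:Z * G r.
  move=> q_gt0; have [le_qR | lt_Rq] := leqP (q * (h + 2)) R.
    rewrite (bigD1_seq (q * (h + 2))%N) ?iota_uniq ?mem_index_iota //=; last lia.
    by rewrite eqxx mul1r big1 ?addr0 // => r /negPf; rewrite eq_sym => ->; rewrite mul0r.
  rewrite G0 // big_nat big1 // => r r_in; rewrite (_ : (_ == r) = false) ?mul0r //.
  lia.
transitivity (\sum_(1 <= r < R.+1) (\sum_(1 <= h < H) \sum_(1 <= q < L.+1)
    (q * (h + 2) == r)%N%:Z) * G r).
  under [RHS]eq_bigr => r _.
    rewrite mulr_suml; under eq_bigr do rewrite mulr_suml; over.
  rewrite [RHS]exchange_big /=; apply: eq_bigr => h _.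
  rewrite [RHS]exchange_big /= big_nat [RHS]big_nat; apply: eq_bigr => q /andP[q_gt0 _].
  exact: pick.
rewrite big_nat [RHS]big_nat; apply: eq_bigr => r /andP[r_gt0 le_rR]; congr (_ * _).
have divE h : (h + 2 %| r)%N%:Z = \sum_(1 <= q < L.+1) (q * (h + 2) == r)%N%:Z.
  have [/dvdnP[q eq_r] | ndiv] := boolP (h + 2 %| r)%N; last first.
    rewrite big1 // => q _; case: eqP => // eq_r.
    by rewrite -eq_r dvdn_mull in ndiv.
  rewrite (bigD1_seq q) ?iota_uniq ?mem_index_iota //=; last nia.
  rewrite eq_r eqxx big1 ?addr0 // => q' neq_q.
  by rewrite eqn_pmul2r ?(negPf neq_q) //; lia.
under eq_bigr do rewrite -divE.
rewrite /large_divisors; have -> : num_divisors r =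
    (1 + ((2 %| r) + \sum_(1 <= h < H) (h + 2 %| r)))%N.
  rewrite (@num_divisorsE r H.+2) //; last lia.
  rewrite big_ltn // big_ltn; last lia.
  by rewrite dvd1n -[3%N]/(1 + 2)%N big_addn subSS subn1.
rewrite !PoszD (big_morph Posz PoszD (erefl 0%:Z)); ring.
Qed.

Theorem theorem9 (n : nat) (n_ge1 : (1 <= n)%N) :
  (total_weak_lr_max n)%:Z =
  \sum_(1 <= r < n.+1)
    ((num_divisors (r + 2))%:Z - (num_divisors r)%:Z) *
    (binomz (2 * n - 1)%N (n%:Z - r%:Z) -
     binomz (2 * n - 1)%N (n%:Z - r%:Z - 1)).
Proof.
rewrite total_weak_lr_maxE.
set N := (2 * n - 1)%N; have eqN : (2 * n)%N = N.+1 by lia.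
pose P (r : int) := ballot N (2 * r - 1).
have P_eq0 r : n%:Z < r -> P r = 0 by move=> lt_nr; apply: ballot_eq0; lia.
(* The cutoff is at least 2n, for [num_recordsE], and at least n + 2, for [sum_multiples]. *)
have records_h h : (0 < h)%N -> num_records h%:Z 0 N.+1 =
    \sum_(1 <= q < (n + 2).*2.+1) P ((q * (h + 2))%N%:Z - 2) -
    \sum_(1 <= q < (n + 2).*2.+1) P (q * (h + 2))%N%:Z.
  move=> h_gt0; rewrite (@num_recordsE h%:Z 0 (n + 2).*2); [|lia|lia|lia|lia].
  (* Passing from length 2n to 2n - 1, the two ballot numbers at 2(h + 2)q - 3 cancel. *)
  rewrite -sumrB; apply: eq_bigr => q _; rewrite !ballotS /P !PoszM !PoszD.
  set x := q%:Z; set y := h%:Z.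
  rewrite (_ : 2 * (y + 2) * x - 4 - 0 - 1 = 2 * (x * (y + 2) - 2) - 1); last ring.
  rewrite (_ : 2 * (y + 2) * x - 2 + 0 + 1 = 2 * (x * (y + 2)) - 1); last ring.
  rewrite (_ : 2 * (y + 2) * x - 4 - 0 + 1 = 2 * (y + 2) * x - 2 + 0 - 1); last ring.
  ring.
rewrite eqN big_nat; under eq_bigr => h /andP[h_gt0 _] do rewrite records_h //.
rewrite -big_nat sumrB.
rewrite (@sum_multiples (fun r => P (r%:Z - 2)) _ _ (n + 2)%N); [|move=> r lt_r; apply: P_eq0; lia|lia|lia|lia].
rewrite (@sum_multiples (fun r => P r%:Z) _ _ n); [|move=> r lt_r; apply: P_eq0; lia|lia|lia|lia].
(* The terms r = 1 and r = 2 are zero; dropping them lets a shift by 2 align the two sums. *)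
rewrite [X in X - _]big_ltn; last lia.
rewrite [X in _ + X - _]big_ltn; last lia.
have -> : large_divisors 1 = 0 by [].
have -> : large_divisors 2 = 0 by [].
rewrite !mul0r !add0r -[3%N]/(1 + 2)%N big_addn (_ : (n + 2).+1 - 2 = n.+1)%N; last lia.
rewrite -sumrB; apply: eq_bigr => r _.
rewrite PoszD addrK -mulrBl; congr (_ * _).
  by rewrite /large_divisors dvdn_addl //; ring.
(* Here N - 2(n - r) = 2r - 1 and N - 2(n - r - 1) = 2r + 1. *)
rewrite /P /ballot -!walks_binomz; congr (walks _ _ - walks _ _); lia.
Qed.
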